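(* Let $d\ge 2$, let $\beta\in\mathbb R^d$ be a non-zero constant vector, and let $\mathcal B_1:=\beta\cdot\nabla$. For $n\in\mathbb N_0$ and $g\in\mathcal P_n$ define $$\mathcal S_1 g:=\frac{1}{|\beta|^2}\sum_{\ell=0}^{n}c_\ell\,(\beta\cdot \boldsymbol r)^{\ell+1}\,\mathcal B_1^{\ell}g,\qquad c_0=1,\quad c_{\ell+1}=-\frac{c_\ell}{(\ell+2)|\beta|^2}\quad(0\le \ell\le n-1).$$ Then $v=\mathcal S_1 g\in\mathcal P_{n+1}$ and $\beta\cdot\nabla v=g$ in $\mathbb R^d$. Consequently, if $\mathcal R_1$ is a linear constant-coefficient partial differential operator containing only derivatives of order at least two, then for any non-zero $f\in\mathcal P_N$ a particular polynomial solution of $$\mathcal R_1u+\beta\cdot\nabla u=f\quad\text{in }\mathbb R^d$$ is given by $$u=\mathcal S_1\sum_{j=0}^{m}\big(-\mathcal R_1\mathcal S_1\big)^jf,$$ where $m\in\mathbb N_0$ is such that $(\mathcal R_1\mathcal S_1)^mf\ne 0$ and $(\mathcal R_1\mathcal S_1)^{m+1}f=0$.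
   Context: $\mathcal P_N$ denotes the space of all $d$-variate polynomials of total degree at most $N$; $\boldsymbol r\in\mathbb R^d$ denotes the position vector (the independent variable), and $|\beta|$ the Euclidean norm of $\beta$. Since $\mathcal B_1^\ell g=0$ for $g\in\mathcal P_n$ and $\ell>n$, the definition of $\mathcal S_1g$ does not depend on the choice of $n$ with $g\in\mathcal P_n$. *)

(* Defs.v *)
From mathcomp Require Import all_boot all_order all_algebra.
From mathcomp Require Import all_classical all_reals all_analysis.
From mathcomp Require Import -(notations) mpoly.

Set Implicit Arguments.
Unset Strict Implicit.
Unset Printing Implicit Defensive.

Import Order.TTheory GRing.Theory Num.Theory.
Import numFieldNormedType.Exports.

Local Open Scope ring_scope.

(* The notations of mpoly clash with those of MathComp-Analysis and are not
   imported; the one for the type of polynomials is restored here. *)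
Notation "{ 'mpoly' T [ n ] }" := (mpoly.mpoly n T)
  (at level 0, T, n at level 2, format "{ 'mpoly'  T [ n ] }") : type_scope.

(* P_N.  [mmeasure mdeg p] is 1 + the total degree of p (and 0 for p = 0), so the
   bound says that the total degree is at most N. *)
Definition polyfun (R : realType) (d N : nat) : set ('rV[R]_d -> R) :=
  [set f | exists p : {mpoly R[d]}, (mmeasure mdeg p <= N.+1)%N /\
     forall x : 'rV[R]_d, f x = meval (fun i => x 0 i) p].

Definition dotv (R : realType) (d : nat) (a x : 'rV[R]_d) : R :=
  \sum_(i < d) a 0 i * x 0 i.

(* The library norm `|x| on 'rV[R]_d is the max norm, hence this definition. *)
Definition enorm (R : realType) (d : nat) (a : 'rV[R]_d) : R :=
  Num.sqrt (\sum_(i < d) a 0 i ^+ 2).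

Definition partial (R : realType) (d : nat) (i : 'I_d)
    (f : 'rV[R]_d -> R) : 'rV[R]_d -> R :=
  fun x => 'D_(delta_mx 0 i) f x.

Definition mpartial (R : realType) (d : nat) (a : multinom d)
    (f : 'rV[R]_d -> R) : 'rV[R]_d -> R :=
  foldr (fun i h => iter (a i) (partial i) h) f (enum 'I_d).

(* A linear constant-coefficient partial differential operator is given by its
   symbol q: the coefficient of the derivative of multi-index a is the
   coefficient of q at the monomial a. *)
Definition diffop (R : realType) (d : nat) (q : {mpoly R[d]})
    (f : 'rV[R]_d -> R) : 'rV[R]_d -> R :=
  fun x => \sum_(a <- msupp q) mcoeff a q * mpartial a f x.

Definition order_ge2 (R : realType) (d : nat) (q : {mpoly R[d]}) : Prop :=
  forall a, a \in msupp q -> (2 <= mdeg a)%N.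

Definition B1 (R : realType) (d : nat) (beta : 'rV[R]_d)
    (f : 'rV[R]_d -> R) : 'rV[R]_d -> R :=
  fun x => \sum_(i < d) beta 0 i * partial i f x.

Fixpoint S1coef (R : realType) (d : nat) (beta : 'rV[R]_d) (l : nat) : R :=
  if l is k.+1 then - (S1coef beta k / (k.+2%:R * enorm beta ^+ 2)) else 1.

(* The defining formula of S_1 g, for a given n such that g is in P_n. *)
Definition S1sum (R : realType) (d : nat) (beta : 'rV[R]_d) (n : nat)
    (g : 'rV[R]_d -> R) : 'rV[R]_d -> R :=
  fun x => (enorm beta ^+ 2)^-1 *
    \sum_(l < n.+1) S1coef beta l * dotv beta x ^+ l.+1 * iter l (B1 beta) g x.

(* S_1 itself takes some n such that g is in P_n; the value does not depend on
   which one.  For g not polynomial, the value is irrelevant. *)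
Definition S1 (R : realType) (d : nat) (beta : 'rV[R]_d)
    (g : 'rV[R]_d -> R) : 'rV[R]_d -> R :=
  S1sum beta (xget 0%N [set n | polyfun n g]) g.

(* Main.v *)
Require Import Defs.
From HB Require Import structures.
From mathcomp Require Import all_boot all_order all_algebra.
From mathcomp Require Import all_classical all_reals all_analysis.
From mathcomp Require Import -(notations) mpoly.
From mathcomp Require Import ring zify.
Import Order.TTheory GRing.Theory Num.Theory.
Import numFieldNormedType.Exports.
Local Open Scope ring_scope.

(** Write b for the squared Euclidean norm of beta and D for the linear form
    r |-> beta . r, so that beta . grad D = b.  With g_l := (beta . grad)^l g, the
    product rule gives
      (beta . grad) (c_l D^(l+1) g_l) = c_l (l+1) b D^l g_l + c_l D^(l+1) g_(l+1),
    and the recursion (l+2) b c_(l+1) = - c_l says that the second term is minus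
    the first term for l+1.  The sum over l <= n telescopes to
    b g - c_(n+1) (n+2) b D^(n+1) g_(n+1), and g_(n+1) = 0 when g has degree at most n
    ([dirderiv_S1poly]).

    For the second claim put T := R_1 S_1.  Since S_1 raises the degree by at most
    one ([msize_S1poly]) and R_1 lowers it by at least two
    ([msize_diffop_poly]), T is nilpotent on polynomials, so the Neumann series of
    1 + T is finite: with w the sum of (- T)^j f for j <= m and u = S_1 w,
      R_1 u + beta . grad u = T w + w = f - (- T)^(m+1) f = f.

    All computations take place in the ring of formal polynomials, where the
    operators are linear maps defined everywhere; [pfun] sends a formal polynomial
    to its function and intertwines them with the analytic operators
    ([partial_pfun], [B1_pfun], [diffop_pfun], [S1_pfun]), so that each identity
    is proved for polynomials and then transported to functions. *)

Local Notation msize p := (@mmeasure _ _ mdeg p).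

(** * Formal polynomials and their derivatives as functions *)

Definition pfun {R : realType} {d : nat} (p : {mpoly R[d]}) : 'rV[R]_d -> R :=
  fun x => meval (fun i => x 0 i) p.

(** A coordinate is a continuous linear form, hence its own differential. *)
Lemma is_derive_coord {R : realType} {d : nat} (x v : 'rV[R]_d) (j : 'I_d) :
  is_derive x v (fun y : 'rV[R]_d => y 0 j) (v 0 j).
Proof.
have lin_coord : linear (fun y : 'rV[R]_d => y 0 j) by move=> a u w; rewrite !mxE.
pose f : {linear 'rV[R]_d -> R} := HB.pack (fun y : 'rV[R]_d => y 0 j : R)
  (GRing.isLinear.Build _ _ _ _ _ lin_coord).
have cf : continuous f by exact: coord_continuous.
have df : differentiable f x by exact: linear_differentiable.
split; first exact: (diff_derivable (f := f)).
by rewrite (deriveE v df) (diff_lin x cf).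
Qed.

Lemma pfunE {R : realType} {d : nat} (p : {mpoly R[d]}) x :
  pfun p x = meval (fun i => x 0 i) p.
Proof. by []. Qed.

Lemma pfunD {R : realType} {d : nat} (p q : {mpoly R[d]}) :
  pfun (p + q) = pfun p + pfun q.
Proof. by apply/funext => x; rewrite /pfun mevalD. Qed.

Lemma mderivXU {R : realType} {d : nat} (i j : 'I_d) :
  mderiv i (mpolyX R (mnm1 j)) = mpolyC d (i == j)%:R.
Proof.
rewrite mderivX mnm1E eq_sym; case: eqP => [->|_]; last by rewrite scale0r mpolyC0.
have -> : mnm_sub (mnm1 j) (mnm1 j) = mnm0.
  by apply/mnmP => k; rewrite mnmBE subnn mnm0E.
by rewrite mpolyX0 scale1r mpolyC1.
Qed.

(** The polynomials for which the formal and the analytic derivative agree contain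
    constants and variables and are stable under sums and products. *)
Lemma is_derive_pfun {R : realType} {d : nat} (i : 'I_d) (x : 'rV[R]_d)
    (p : {mpoly R[d]}) :
  is_derive x (delta_mx 0 i) (pfun p) (pfun (mderiv i p) x).
Proof.
pose P (q : {mpoly R[d]}) :=
  is_derive x (delta_mx 0 i) (pfun q) (pfun (mderiv i q) x).
have PC c : P (mpolyC d c).
  rewrite /P mderivC /pfun meval0.
  rewrite (_ : (fun _ => _) = cst c); first exact: is_derive_cst.
  by apply/funext => y; rewrite mevalC.
have PM q r : P q -> P r -> P (q * r).
  move=> Pq Pr; rewrite /P mderivM.
  rewrite (_ : pfun (q * r) = pfun q * pfun r); last first.
    by apply/funext => y; rewrite /pfun mevalM.
  apply: (is_derive_eq (is_deriveM Pq Pr)); rewrite /pfun mevalD !mevalM.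
  by rewrite addrC; congr (_ + _); rewrite mulrC.
have PX j : P (mpolyX R (mnm1 j)).
  rewrite /P (_ : pfun (mpolyX R (mnm1 j)) = fun y : 'rV[R]_d => y 0 j); last first.
    by apply/funext => y; rewrite /pfun mevalXU.
  apply: (is_derive_eq (is_derive_coord x _ j)).
  by rewrite mxE eqxx mderivXU /pfun mevalC eq_sym.
elim/mpolyind: p => [|c m p _ _ IHp].
  by rewrite -mpolyC0; exact: PC.
rewrite mderivD !pfunD; apply: is_deriveD IHp.
rewrite -mul_mpolyC; apply: (PM) => //.
rewrite mpolyXE_id; apply: (big_ind P) => //; first exact: PC.
move=> k _; elim: (m k) => [|n IHn]; first exact: PC.
by rewrite exprS; exact: PM.
Qed.

Lemma partial_pfun {R : realType} {d : nat} (i : 'I_d) (p : {mpoly R[d]}) :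
  partial i (pfun p) = pfun (mderiv i p).
Proof. by apply/funext => x; have [_] := is_derive_pfun i x p. Qed.

(** * The operators on formal polynomials *)

Section PolynomialOperators.
Context {R : realType} {d : nat} (beta : 'rV[R]_d).
Implicit Types p q : {mpoly R[d]}.

Definition dirderiv p : {mpoly R[d]} := \sum_(i < d) beta 0 i *: mderiv i p.

Lemma dirderiv_is_linear : linear dirderiv.
Proof.
move=> c p q; rewrite /dirderiv scaler_sumr -big_split /=; apply: eq_bigr => i _.
by rewrite linearP scalerDr !scalerA mulrC.
Qed.
HB.instance Definition _ := GRing.isLinear.Build R _ _ _ dirderiv dirderiv_is_linear.

Lemma B1_pfun p : B1 beta (pfun p) = pfun (dirderiv p).
Proof.
apply/funext => x; rewrite /B1 pfunE linear_sum /=; apply: eq_bigr => i _.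
by rewrite partial_pfun mevalZ.
Qed.

Definition diffop_poly q p : {mpoly R[d]} :=
  \sum_(a <- msupp q) mcoeff a q *: mderivm a p.

Lemma diffop_poly_is_linear q : linear (diffop_poly q).
Proof.
move=> c p r; rewrite /diffop_poly scaler_sumr -big_split /=.
by apply: eq_bigr => a _; rewrite linearP scalerDr !scalerA mulrC.
Qed.
HB.instance Definition _ q :=
  GRing.isLinear.Build R _ _ _ (diffop_poly q) (diffop_poly_is_linear q).

Lemma mpartial_pfun a p : mpartial a (pfun p) = pfun (mderivm a p).
Proof.
rewrite /mpartial /mderivm; elim: (enum _) => //= i s ->.
by elim: (a i) => //= n ->; rewrite partial_pfun.
Qed.

Lemma diffop_pfun q p : diffop q (pfun p) = pfun (diffop_poly q p).
Proof.
apply/funext => x; rewrite /diffop pfunE linear_sum /=; apply: eq_bigr => a _.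
by rewrite mpartial_pfun mevalZ.
Qed.

Definition beta_form : {mpoly R[d]} := \sum_(i < d) beta 0 i *: mpolyX R (mnm1 i).

(** Total in [n] and [p], hence linear in [p] for fixed [n]; it represents S_1 only
    on polynomials of degree at most [n], see [S1_pfun]. *)
Definition S1poly (n : nat) p : {mpoly R[d]} :=
  (enorm beta ^+ 2)^-1 *:
    \sum_(l < n.+1) S1coef beta l *: (beta_form ^+ l.+1 * iter l dirderiv p).

Lemma iter_dirderiv_linear l : linear (iter l dirderiv).
Proof. by move=> c p q; elim: l => //= l ->; rewrite linearP. Qed.

Lemma S1poly_is_linear n : linear (S1poly n).
Proof.
move=> c p q; rewrite /S1poly scalerA mulrC -scalerA -scalerDr.
congr (_ *: _); rewrite scaler_sumr -big_split /=; apply: eq_bigr => l _.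
rewrite iter_dirderiv_linear mulrDr scalerDr -scalerAr !scalerA.
by rewrite [c * _]mulrC.
Qed.
HB.instance Definition _ n :=
  GRing.isLinear.Build R _ _ _ (S1poly n) (S1poly_is_linear n).

Lemma dirderivZ c p : dirderiv (c *: p) = c *: dirderiv p.
Proof. exact: linearZ. Qed.

Lemma dirderivM p q : dirderiv (p * q) = dirderiv p * q + p * dirderiv q.
Proof.
rewrite /dirderiv mulr_suml mulr_sumr -big_split /=; apply: eq_bigr => i _.
by rewrite mderivM scalerDr scalerAl scalerAr.
Qed.

Lemma dirderivX_succ p n : dirderiv (p ^+ n.+1) = n.+1%:R *: (p ^+ n * dirderiv p).
Proof.
elim: n => [|n IHn]; first by rewrite expr1 expr0 mul1r scale1r.
rewrite exprS dirderivM {}IHn -scalerAr mulrA -exprS [dirderiv p * _]mulrC.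
by rewrite -[in RHS]natr1 scalerDl scale1r addrC.
Qed.

Lemma enorm_sqr : enorm beta ^+ 2 = \sum_(i < d) beta 0 i ^+ 2.
Proof. by rewrite sqr_sqrtr // sumr_ge0 // => i _; rewrite sqr_ge0. Qed.

Lemma dirderiv_beta_form : dirderiv beta_form = mpolyC d (enorm beta ^+ 2).
Proof.
rewrite enorm_sqr /dirderiv /beta_form [RHS]raddf_sum; apply: eq_bigr => i _.
rewrite [mderiv i _]linear_sum /= (bigD1 i) //= big1 ?addr0 => [|j jNi]; last first.
  by rewrite mderivZ mderivXU eq_sym (negPf jNi) mpolyC0 !scaler0.
by rewrite mderivZ mderivXU eqxx mpolyC1 scalerA alg_mpolyC expr2.
Qed.

(** * Degree bounds *)

Lemma msize_mderiv i p : (msize (mderiv i p) <= (msize p).-1)%N.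
Proof.
rewrite {1}mmeasureE big_seq; apply/bigmax_leqP_seq => m + _.
rewrite mcoeff_msupp mcoeff_mderiv => /negP pm.
have : mnm_add m (mnm1 i) \in msupp p.
  by rewrite mcoeff_msupp; apply/negP => /eqP p0; apply: pm; rewrite p0 mul0rn.
by move=> /msize_mdeg_lt; rewrite mdegD mdeg1 addn1; case: (msize p).
Qed.

Lemma msize_mderivm a p : (msize (mderivm a p) <= msize p - mdeg a)%N.
Proof.
have size_iter i n q : (msize (iter n (mderiv i) q) <= msize q - n)%N.
  elim: n => [|n IHn]; first by rewrite subn0.
  apply: (leq_trans (msize_mderiv _ _)).
  by rewrite subnS -!subn1 leq_sub2r.
rewrite mdegE -big_enum /mderivm /=.
elim: (enum _) => [|i s IHs]; first by rewrite big_nil subn0.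
rewrite big_cons /= addnC subnDA; apply: (leq_trans (size_iter _ _ _)).
exact: leq_sub2r.
Qed.

Lemma msize_sum_le (I : Type) (s : seq I) (P : pred I) (F : I -> {mpoly R[d]}) n :
  (forall i, P i -> (msize (F i) <= n)%N) -> (msize (\sum_(i <- s | P i) F i) <= n)%N.
Proof.
move=> Fn; apply: (big_ind (fun p => (msize p <= n)%N)) => [|p q pn qn|//].
  by rewrite mmeasure0.
by apply: (leq_trans (mmeasureD_le _ _ _)); rewrite geq_max pn.
Qed.

Lemma msize_dirderiv p : (msize (dirderiv p) <= (msize p).-1)%N.
Proof.
apply: msize_sum_le => i _.
exact: (leq_trans (msizeZ_le _ _) (msize_mderiv _ _)).
Qed.

Lemma msize_iter_dirderiv l p : (msize (iter l dirderiv p) <= msize p - l)%N.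
Proof.
elim: l => [|l IHl]; first by rewrite subn0.
by apply: (leq_trans (msize_dirderiv _)); rewrite subnS -!subn1 leq_sub2r.
Qed.

Lemma iter_dirderiv_eq0 l p : (msize p <= l)%N -> iter l dirderiv p = 0.
Proof.
rewrite -subn_eq0 => /eqP pl; apply/eqP.
by rewrite -(mmeasure_poly_eq0 mdeg) -leqn0 -pl msize_iter_dirderiv.
Qed.

Lemma msize_beta_formX l : (msize (beta_form ^+ l) <= l.+1)%N.
Proof.
have s1 : (msize beta_form <= 2)%N.
  apply: msize_sum_le => i _; apply: (leq_trans (msizeZ_le _ _)).
  by rewrite msizeX mdeg1.
elim: l => [|l IHl]; first by rewrite expr0 msize1.
have [->|p0] := eqVneq beta_form 0; first by rewrite expr0n mmeasure0.
rewrite exprS msizeM ?expf_neq0 //.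
by move: s1 IHl; move: (msize _) (msize _) => a b; lia.
Qed.

(** The degree gained by the factor [beta_form ^+ l.+1] is compensated, up to one,
    by the [l] derivatives; summands with more derivatives than the degree of [p]
    vanish, so the bound is uniform in [n]. *)
Lemma msize_S1poly n p : (msize (S1poly n p) <= (msize p).+1)%N.
Proof.
apply: (leq_trans (msizeZ_le _ _)); apply: msize_sum_le => l _.
apply: (leq_trans (msizeZ_le _ _)).
have [->|q0] := eqVneq (iter l dirderiv p) 0; first by rewrite mulr0 mmeasure0.
have [->|p0] := eqVneq (beta_form ^+ l.+1) 0; first by rewrite mul0r mmeasure0.
rewrite msizeM //.
have := msize_beta_formX l.+1; have := msize_iter_dirderiv l p.
have : msize (iter l dirderiv p) != 0%N by rewrite mmeasure_poly_eq0.
move: (msize (_ ^+ _)) (msize (iter _ _ _)) (msize p) => a b c.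
lia.
Qed.

Lemma msize_diffop_poly q p : order_ge2 q ->
  (msize (diffop_poly q p) <= msize p - 2)%N.
Proof.
move=> q2; rewrite /diffop_poly big_seq; apply: msize_sum_le => a /q2 a2.
apply: (leq_trans (msizeZ_le _ _)); apply: (leq_trans (msize_mderivm _ _)).
exact: leq_sub2l.
Qed.

(** * The right inverse of the directional derivative *)

(** Applying the derivation to the l-th summand gives [t l - t l.+1]: the product
    rule produces two terms, and the recursion of the coefficients turns the
    second one into [- t l.+1].  The sum telescopes to [t 0 - t n.+1], where
    [t 0] is [p] times the squared norm and [t n.+1] vanishes for degree reasons. *)
Lemma dirderiv_S1poly n p : beta != 0 -> (msize p <= n.+1)%N ->
  dirderiv (S1poly n p) = p.
Proof.
move=> beta0 pn.
have b0 : enorm beta ^+ 2 != 0.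
  rewrite enorm_sqr; apply: contra beta0.
  rewrite psumr_eq0 => [/allP b0|i _]; last exact: sqr_ge0.
  apply/eqP/rowP => i; rewrite mxE; apply/eqP; rewrite -sqrf_eq0.
  exact: (implyP (b0 i (mem_index_enum i))).
pose t l := (S1coef beta l * l.+1%:R * enorm beta ^+ 2) *:
  (beta_form ^+ l * iter l dirderiv p).
have dirderiv_sum (F : 'I_n.+1 -> {mpoly R[d]}) :
    dirderiv (\sum_l F l) = \sum_l dirderiv (F l) by exact: linear_sum.
rewrite dirderivZ dirderiv_sum.
under eq_bigr => l _.
  rewrite dirderivZ dirderivM dirderivX_succ dirderiv_beta_form.
  rewrite [X in X * _](_ : _ =
     (l.+1%:R * enorm beta ^+ 2) *: beta_form ^+ l); last first.
    by rewrite [_ ^+ l * _]mulrC mul_mpolyC scalerA.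
  rewrite scalerDr -scalerAl scalerA mulrA -/(t l).
  rewrite (_ : S1coef beta l *: _ = - t l.+1); last first.
    rewrite /t /= -scaleNr; congr (_ *: _).
    field; move: b0; rewrite expf_eq0 /= => -> /=.
    by rewrite -natrD pnatr_eq0.
  over.
rewrite -(big_mkord xpredT (fun l => t l - t l.+1)).
rewrite (telescope_sumr_eq (fun l => - t l)) //; last first.
  by move=> l _; rewrite opprK addrC.
rewrite opprK /t iter_dirderiv_eq0 // mulr0 scaler0 oppr0 add0r.
by rewrite !mul1r scalerA mulVf // scale1r.
Qed.

(** * The integral operator on polynomial functions *)

Lemma iter_B1_pfun l p : iter l (B1 beta) (pfun p) = pfun (iter l dirderiv p).
Proof. by elim: l => //= l ->; rewrite B1_pfun. Qed.

Lemma S1sum_pfun n p : S1sum beta n (pfun p) = pfun (S1poly n p).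
Proof.
apply/funext => x; rewrite /S1sum /S1poly pfunE mevalZ linear_sum /=.
congr (_ * _); apply: eq_bigr => l _.
rewrite mevalZ mevalM iter_B1_pfun rmorphXn /= mulrA; congr (_ * _ ^+ _ * _).
rewrite linear_sum /=; apply: eq_bigr => i _.
by rewrite mevalZ mevalXU.
Qed.

(** The additional summands contain derivatives of order exceeding the degree. *)
Lemma S1sum_widen n k p : (msize p <= n.+1)%N -> (n <= k)%N ->
  S1sum beta k (pfun p) = S1sum beta n (pfun p).
Proof.
move=> pn nk; rewrite !S1sum_pfun; congr pfun; congr (_ *: _).
rewrite [RHS](big_ord_widen k.+1
  (fun l => S1coef beta l *: (beta_form ^+ l.+1 * iter l dirderiv p))) //.
rewrite [RHS]big_mkcond; apply: eq_bigr => l _; case: ltnP => // nl.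
by rewrite iter_dirderiv_eq0 ?mulr0 ?scaler0 // (leq_trans pn).
Qed.

(** The bound picked by [S1] may come with another formal polynomial for the same
    function; both bounds are compared with their maximum. *)
Lemma S1_pfun n p : (msize p <= n.+1)%N -> S1 beta (pfun p) = pfun (S1poly n p).
Proof.
move=> pn; rewrite -S1sum_pfun /S1.
have : polyfun (xget 0%N [set n | polyfun n (pfun p)]) (pfun p).
  by apply: (@xgetPex _ 0%N [set n | polyfun n (pfun p)]); exists n; exists p.
move: (xget _ _) => n' [p' [p'n' pp']].
have {}pp' : pfun p = pfun p' by apply/funext.
rewrite -(S1sum_widen _ _ _ pn (leq_maxl n n')) pp'.
by rewrite (S1sum_widen _ _ _ p'n' (leq_maxr n n')).
Qed.

End PolynomialOperators.

(** * The particular solution *)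

Theorem mainTheorem2 (R : realType) (d : nat) (hd : (2 <= d)%N)
    (beta : 'rV[R]_d) (hbeta : beta != 0) :
  (forall (n : nat) (g : 'rV[R]_d -> R), polyfun n g ->
     [/\ S1 beta g = S1sum beta n g,
         polyfun n.+1 (S1 beta g) &
         forall x : 'rV[R]_d, B1 beta (S1 beta g) x = g x]) /\
  (forall (q : {mpoly R[d]}), order_ge2 q ->
   forall (N : nat) (f : 'rV[R]_d -> R), polyfun N f -> f <> 0 ->
     let R1 := diffop q in
     let T := fun h : 'rV[R]_d -> R => R1 (S1 beta h) in
     (exists m : nat, iter m T f <> 0 /\ iter m.+1 T f = 0) /\
     (forall m : nat, iter m T f <> 0 -> iter m.+1 T f = 0 ->
        let u := S1 beta (\sum_(j < m.+1) iter j (fun h => - T h) f) in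
        (exists M : nat, polyfun M u) /\
        forall x : 'rV[R]_d, R1 u x + B1 beta u x = f x)).
Proof.
split=> [n g [p [pn /funext gp]]|q q2 N f [p [pN /funext fp]] f0 R1 T].
  have {gp} -> : g = pfun p by exact: gp.
  rewrite (S1_pfun beta n p pn) S1sum_pfun; split=> // [|x].
    exists (S1poly beta n p); split=> //.
    exact: (leq_trans (msize_S1poly beta n p)).
  by rewrite B1_pfun dirderiv_S1poly.
have {}fp : f = pfun p by exact: fp.
pose Tp r := diffop_poly q (S1poly beta N r).
have Tpfun r : (msize r <= N.+1)%N -> T (pfun r) = pfun (Tp r).
  by move=> rN; rewrite /T (S1_pfun beta N) // /R1 diffop_pfun.
have TpZ c r : Tp (c *: r) = c *: Tp r.
  by rewrite /Tp [S1poly _ _ _]linearZ; exact: linearZ.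
have Tp_sum m (F : 'I_m -> {mpoly R[d]}) : Tp (\sum_j F j) = \sum_j Tp (F j).
  by rewrite /Tp [S1poly _ _ _]linear_sum; exact: linear_sum.
have msizeTp r : (msize (Tp r) <= (msize r).-1)%N.
  apply: (leq_trans (msize_diffop_poly q _ q2)).
  by have := msize_S1poly beta N r; move: (msize _) (msize _) => a b; lia.
(* All iterates stay in the degree range where S_1 is [S1poly beta N]. *)
have sizeT j : (msize (iter j Tp p) <= N.+1 - j)%N.
  elim: j => [|j IHj]; first by rewrite subn0.
  by apply: (leq_trans (msizeTp _)); rewrite subnS -!subn1 leq_sub2r.
have iterT j : iter j T f = pfun (iter j Tp p).
  elim: j => [//|j IHj]; rewrite !iterS IHj Tpfun //.
  exact: (leq_trans (sizeT j) (leq_subr _ _)).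
have iterNTp j : iter j (fun r => - Tp r) p = (-1) ^+ j *: iter j Tp p.
  elim: j => [|j IHj]; first by rewrite scale1r.
  by rewrite !iterS IHj TpZ exprS mulN1r scaleNr.
have sizeNT j : (msize (iter j (fun r => - Tp r) p) <= N.+1)%N.
  rewrite iterNTp; apply: (leq_trans (msizeZ_le _ _)).
  exact: (leq_trans (sizeT j) (leq_subr _ _)).
have iterNT j : iter j (fun h => - T h) f = pfun (iter j (fun r => - Tp r) p).
  elim: j => [//|j IHj]; rewrite !iterS IHj Tpfun //.
  by apply/funext => x; rewrite /pfun mevalN.
split.
  have vanish : exists k, iter k T f == 0.
    exists N.+1; apply/eqP; rewrite iterT.
    have := sizeT N.+1; rewrite subnn leqn0 mmeasure_poly_eq0 => /eqP ->.
    by apply/funext => x; rewrite /pfun meval0.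
  case: (ex_minnP vanish) => -[/eqP //|m] /eqP Tm mmin.
  by exists m; split=> // /eqP /mmin; rewrite ltnn.
move=> m _ Tm u.
pose w := \sum_(j < m.+1) iter j (fun r => - Tp r) p.
have wN : (msize w <= N.+1)%N by exact: msize_sum_le.
have uE : u = pfun (S1poly beta N w).
  rewrite /u -(S1_pfun beta N w wN); congr (S1 beta _).
  under eq_bigr do rewrite iterNT.
  by apply/funext => x; rewrite fct_sumE pfunE linear_sum.
split; first by exists N.+1, (S1poly beta N w); split;
  [exact: (leq_trans (msize_S1poly _ _ _)) | rewrite uE].
move=> x; rewrite uE B1_pfun dirderiv_S1poly // /R1 diffop_pfun -/(Tp w).
have telescoped : Tp w + w = p - iter m.+1 (fun r => - Tp r) p.
  rewrite /w Tp_sum -big_split /=.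
  rewrite -(big_mkord xpredT (fun j =>
    Tp (iter j (fun r => - Tp r) p) + iter j (fun r => - Tp r) p)).
  rewrite (telescope_sumr_eq (fun j => - iter j (fun r => - Tp r) p)) //.
    by rewrite /= !opprK addrC.
  by move=> j _; rewrite /= !opprK.
rewrite !pfunE -mevalD telescoped mevalB -!pfunE -iterNT -fp.
suff -> : iter m.+1 (fun h => - T h) f = 0 by rewrite subr0.
rewrite iterNT iterNTp; apply/funext => y.
by rewrite pfunE mevalZ -pfunE -iterT Tm mulr0.
Qed.
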